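(* Let $I\subseteq\mathbb R$ be an open interval, let $\mathbf A:I\to\mathbb H^{n\times n}$ be continuous, and let $\{\mathbf x_1,\dots,\mathbf x_n\}$ be a left linearly independent set of solutions on $I$ of the homogeneous left system $\mathbf x'=\mathbf x\mathbf A(t)$. Then for every solution $\mathbf x$ of this system on $I$ there exist constant quaternions $q_1,\dots,q_n\in\mathbb H$ such that $$\mathbf x(t)=q_1\mathbf x_1(t)+\dots+q_n\mathbf x_n(t)\qquad(t\in I).$$
   Context: $\mathbb H$ is the real quaternion skew field. Solutions of $\mathbf x'=\mathbf x\mathbf A(t)$ are differentiable row-vector functions $\mathbf x:I\to\mathbb H^{1\times n}$ of the real variable $t$; derivatives are componentwise. A set of row-vector functions $\{\mathbf x_1,\dots,\mathbf x_n\}$ is left linearly dependent on $I$ if there exist constants $q_1,\dots,q_n\in\mathbb H$, not all zero, such that $q_1\mathbf x_1(t)+\dots+q_n\mathbf x_n(t)=\mathbf 0$ for all $t\in I$; it is left linearly independent otherwise. *)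

(* Defs.v *)
From HB Require Import structures.
From mathcomp Require Import all_boot all_order all_algebra.
From mathcomp Require Import ring.
From mathcomp Require Import all_classical all_reals all_analysis.
Set Implicit Arguments.
Unset Strict Implicit.
Unset Printing Implicit Defensive.
Import Order.TTheory GRing.Theory Num.Theory.
Import numFieldNormedType.Exports.
Local Open Scope classical_set_scope.
Local Open Scope ring_scope.

(* The quaternion a + b i + c j + d k is the vector (a, b, c, d) of R^4, from
   which quat R inherits its real vector space structure and its topology.
   Pitfall: `|q| is therefore the sup norm of R^4, not the (equivalent)
   multiplicative norm of the quaternions. *)
Definition quat (R : realType) : Type := 'rV[R]_4.

HB.instance Definition _ (R : realType) := NormedModule.copy (quat R) 'rV[R]_4.

Section Quaternion.
Variable R : realType.
Implicit Types p q : quat R.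

Definition Quat (a b c d : R) : quat R := \row_(l < 4) [:: a; b; c; d]`_l.

Definition qre q : R := (q : 'rV[R]_4) 0 0.
Definition qi q : R := (q : 'rV[R]_4) 0 1.
Definition qj q : R := (q : 'rV[R]_4) 0 2.
Definition qk q : R := (q : 'rV[R]_4) 0 3.

Lemma quatE p q : qre p = qre q -> qi p = qi q -> qj p = qj q -> qk p = qk q ->
  p = q.
Proof.
move=> e0 e1 e2 e3; apply/rowP => -[[|[|[|[|//]]]] lt4].
- by rewrite (_ : Ordinal _ = 0) //; apply/val_inj.
- by rewrite (_ : Ordinal _ = 1) //; apply/val_inj.
- by rewrite (_ : Ordinal _ = 2) //; apply/val_inj.
- by rewrite (_ : Ordinal _ = 3) //; apply/val_inj.
Qed.

Lemma qreE a b c d : qre (Quat a b c d) = a. Proof. by rewrite /qre mxE. Qed.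
Lemma qiE a b c d : qi (Quat a b c d) = b. Proof. by rewrite /qi mxE. Qed.
Lemma qjE a b c d : qj (Quat a b c d) = c. Proof. by rewrite /qj mxE. Qed.
Lemma qkE a b c d : qk (Quat a b c d) = d. Proof. by rewrite /qk mxE. Qed.
Definition QuatE := (qreE, qiE, qjE, qkE).

Lemma qreD p q : qre (p + q) = qre p + qre q. Proof. exact: mxE. Qed.
Lemma qiD p q : qi (p + q) = qi p + qi q. Proof. exact: mxE. Qed.
Lemma qjD p q : qj (p + q) = qj p + qj q. Proof. exact: mxE. Qed.
Lemma qkD p q : qk (p + q) = qk p + qk q. Proof. exact: mxE. Qed.
Definition quatDE := (qreD, qiD, qjD, qkD).

(* i^2 = j^2 = k^2 = ijk = -1 *)
Definition quat_mul p q : quat R := Quat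
  (qre p * qre q - qi p * qi q - qj p * qj q - qk p * qk q)
  (qre p * qi q + qi p * qre q + qj p * qk q - qk p * qj q)
  (qre p * qj q - qi p * qk q + qj p * qre q + qk p * qi q)
  (qre p * qk q + qi p * qj q - qj p * qi q + qk p * qre q).

Definition quat_one : quat R := Quat 1 0 0 0.

Lemma quat_mulA : associative quat_mul.
Proof. by move=> p q r; apply: quatE; rewrite /quat_mul !QuatE; ring. Qed.
Lemma quat_mul1l : left_id quat_one quat_mul.
Proof. by move=> p; apply: quatE; rewrite /quat_mul !QuatE; ring. Qed.
Lemma quat_mul1r : right_id quat_one quat_mul.
Proof. by move=> p; apply: quatE; rewrite /quat_mul !QuatE; ring. Qed.
Lemma quat_mulDl : left_distributive quat_mul +%R.
Proof.
by move=> p q r; apply: quatE; rewrite /quat_mul ?quatDE !QuatE ?quatDE; ring.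
Qed.
Lemma quat_mulDr : right_distributive quat_mul +%R.
Proof.
by move=> p q r; apply: quatE; rewrite /quat_mul ?quatDE !QuatE ?quatDE; ring.
Qed.
Lemma quat_one_neq0 : quat_one != 0.
Proof.
apply/eqP => /(congr1 qre); rewrite QuatE /qre mxE => /eqP.
by rewrite oner_eq0.
Qed.

HB.instance Definition _ := GRing.Zmodule_isNzRing.Build (quat R)
  quat_mulA quat_mul1l quat_mul1r quat_mulDl quat_mulDr quat_one_neq0.

Definition quat_sqnorm q : R := qre q ^+ 2 + qi q ^+ 2 + qj q ^+ 2 + qk q ^+ 2.

Definition quat_inv q : quat R := Quat
  (qre q / quat_sqnorm q) (- qi q / quat_sqnorm q)
  (- qj q / quat_sqnorm q) (- qk q / quat_sqnorm q).

Lemma quat_sqnorm_eq0 q : (quat_sqnorm q == 0) = (q == 0).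
Proof.
apply/idP/eqP => [|->]; last first.
  by rewrite /quat_sqnorm /qre /qi /qj /qk !mxE expr0n !addr0.
rewrite /quat_sqnorm !paddr_eq0 ?addr_ge0 ?sqr_ge0 // !sqrf_eq0.
by case/andP=> /andP[/andP[/eqP e0 /eqP e1] /eqP e2] /eqP e3;
  apply: quatE; rewrite ?e0 ?e1 ?e2 ?e3 /qre /qi /qj /qk mxE.
Qed.

Lemma quat_mulVl : {in [pred q | q != 0], left_inverse 1 quat_inv *%R}.
Proof.
move=> q; rewrite inE -quat_sqnorm_eq0 => q0.
change (quat_mul (quat_inv q) q = quat_one).
by apply: quatE; rewrite /quat_mul !QuatE; rewrite /quat_sqnorm in q0 *; field.
Qed.

Lemma quat_mulVr : {in [pred q | q != 0], right_inverse 1 quat_inv *%R}.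
Proof.
move=> q; rewrite inE -quat_sqnorm_eq0 => q0.
change (quat_mul q (quat_inv q) = quat_one).
by apply: quatE; rewrite /quat_mul !QuatE; rewrite /quat_sqnorm in q0 *; field.
Qed.

Lemma quat_unitP p q : q * p = 1 /\ p * q = 1 -> p != 0.
Proof.
case=> qp1 _; apply/eqP => p0; move: qp1; rewrite p0 mulr0 => /esym/eqP.
by rewrite oner_eq0.
Qed.

Lemma quat_inv_out : {in [predC [pred q : quat R | q != 0]], quat_inv =1 id}.
Proof.
move=> q; rewrite !inE negbK => /eqP ->.
by apply: quatE; rewrite QuatE /qre /qi /qj /qk !mxE ?oppr0 mul0r.
Qed.

HB.instance Definition _ := GRing.NzRing_hasMulInverse.Build (quat R)
  quat_mulVl quat_mulVr quat_unitP quat_inv_out.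

End Quaternion.

Definition is_solution (R : realType) (n : nat) (I : set R)
    (A : R -> 'M[quat R]_n) (x : R -> 'rV[quat R]_n) : Prop :=
  forall t : R, I t -> forall j : 'I_n,
    is_derive t 1 (fun s : R => x s 0 j) ((x t *m A t) 0 j).

(* On matrices over quat R, q *: v multiplies every entry of v by q on the
   left. *)
Definition left_dependent (R : realType) (n m : nat) (I : set R)
    (x : 'I_m -> R -> 'rV[quat R]_n) : Prop :=
  exists q : 'I_m -> quat R, (exists i : 'I_m, q i != 0) /\
    forall t : R, I t -> \sum_(i < m) q i *: x i t = 0.

Definition left_independent (R : realType) (n m : nat) (I : set R)
    (x : 'I_m -> R -> 'rV[quat R]_n) : Prop := ~ left_dependent I x.

(* Main.v *)
Require Import Defs.
From HB Require Import structures.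
From mathcomp Require Import all_boot all_order all_algebra.
From mathcomp Require Import ring lra.
From mathcomp Require Import all_classical all_reals all_analysis.
Set Implicit Arguments.
Unset Strict Implicit.
Unset Printing Implicit Defensive.
Import Order.TTheory GRing.Theory Num.Theory.
Import numFieldNormedType.Exports.
Local Open Scope classical_set_scope.
Local Open Scope ring_scope.

(** Solutions of x' = x A(t) are closed under left quaternionic combinations,
    because constants multiply on the left and A on the right
    ([is_solution_lincomb]), and a solution vanishing at one point of I vanishes
    throughout I ([is_solution_eq0]). Hence evaluation at a fixed t0 in I is an
    injective left-linear map from solutions to rows of length n: the
    independent solutions X_i have independent values X_i(t0), n independent
    rows of length n span all rows ([quat_independent_span]), so
    x(t0) = \sum q_i X_i(t0) for some constants q_i, and the solution
    x - \sum q_i X_i, which vanishes at t0, is identically zero.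

    Uniqueness comes from an energy estimate. Let N be the multiplicative
    squared norm of the quaternions, < , > its inner product and
    E = \sum_j N(x_j). Then
    E' = \sum_(j, k) 2 <x_j, x_k A_kj>, and |2 <p, q>| <= N(p) + N(q) together
    with N(p q) = N(p) N(q) gives |E'| <= n (1 + c) E wherever c bounds every
    N(A_kj) ([row_energy_dot_le]). Such a c exists on the segment between two
    points of I by compactness, and Gronwall's inequality ([gronwall_eq0])
    propagates E = 0 from one end of the segment to the other.

    The spanning statement is reduced to commutative linear algebra by viewing
    the quaternions as a real vector space of dimension 4: the map sending the
    coefficients q to \sum q_i v_i is an injective endomorphism of a
    finite-dimensional real space, hence surjective. *)

(** * Derivatives and linear maps *)

Lemma linear_rV_continuous (R : realType) (W : normedModType R) (n : nat)
    (phi : {linear 'rV[R]_n -> W}) : continuous phi.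
Proof.
have phiE : (phi : 'rV[R]_n -> W) =
    (fun w : 'rV[R]_n => \sum_(l < n) w 0 l *: phi (delta_mx 0 l)).
  apply/funext => w; rewrite [in LHS](row_sum_delta w) linear_sum.
  by apply: eq_bigr => l _; rewrite linearZ.
rewrite phiE; apply: continuous_big => [|l _]; first exact: add_continuous.
move=> u; apply: (@cvgZr_tmp _ _ _ (nbhs u));
  exact: (@coord_continuous R 1 n 0 l u).
Qed.

(** A linear map commutes with the formation of difference quotients, and a
    continuous one with their limit. *)
Lemma is_derive_linear (R : realType) (U V W : normedModType R)
    (phi : {linear V -> W}) (f : U -> V) (t v : U) (df : V) :
  continuous phi -> is_derive t v f df -> is_derive t v (phi \o f) (phi df).
Proof.
move=> phi_cont [f_derivable f_derive].
have quotient_cvg : h^-1 *: (phi (f (h *: v + t)) - phi (f t))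
    @[h --> (0 : R)^'] --> phi df.
  under eq_fun do rewrite -linearB -linearZ.
  have f_cvg : h^-1 *: (f (h *: v + t) - f t) @[h --> (0 : R)^'] --> df.
    by rewrite -f_derive.
  exact: (cvg_comp _ _ f_cvg (phi_cont df)).
split; first by apply/cvg_ex; exists (phi df).
exact: cvg_lim quotient_cvg.
Qed.

(** * A Gronwall uniqueness principle *)

(** The inequality |E'| <= C E makes E exp(-Cu) nonincreasing and E exp(Cu)
    nondecreasing: the first function carries the zero at s to the right, the
    second to the left. *)
Lemma gronwall_eq0 (R : realType) (E dE : R -> R) (C a b s t : R)
    (E_ge0 : forall u, u \in `[a, b] -> 0 <= E u)
    (E_derive : forall u, u \in `[a, b] -> is_derive u 1 E (dE u))
    (dE_le : forall u, u \in `[a, b] -> `|dE u| <= C * E u) :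
  s \in `[a, b] -> t \in `[a, b] -> E s = 0 -> E t = 0.
Proof.
move=> s_ab t_ab Es0.
have weighted_derive (c u : R) : u \in `[a, b] ->
    is_derive u 1 (E * (expR \o (c \*: id))) (expR (c * u) * (dE u + c * E u)).
  move=> u_ab; have := E_derive _ u_ab => E_der.
  by apply: is_derive_eq; rewrite /= /GRing.scale /=; ring.
have weighted_cont c : {within `[a, b], continuous (E * (expR \o (c \*: id)))}.
  apply: derivable_within_continuous => u u_ab.
  by have [] := weighted_derive c u u_ab.
apply/eqP; rewrite eq_le E_ge0// andbT.
have /orP[st|ts] := le_total s t.
- have : (E * (expR \o (- C \*: id))) t <= (E * (expR \o (- C \*: id))) s.
    apply: (ler0_derive1_le_cc _ _ (weighted_cont _)) => //.
    + move=> u /subset_itv_oo_cc u_ab.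
      by have [] := weighted_derive (- C) u u_ab.
    + move=> u /subset_itv_oo_cc u_ab.
      rewrite derive1E; have [_ ->] := weighted_derive (- C) u u_ab.
      apply: mulr_ge0_le0; first exact: expR_ge0.
      by have := dE_le u u_ab; rewrite ler_norml; lra.
  by rewrite /= /GRing.mul /= Es0 mul0r pmulr_lle0 ?expR_gt0.
- have : (E * (expR \o (C \*: id))) t <= (E * (expR \o (C \*: id))) s.
    apply: (ger0_derive1_le_cc _ _ (weighted_cont _)) => //.
    + move=> u /subset_itv_oo_cc u_ab.
      by have [] := weighted_derive C u u_ab.
    + move=> u /subset_itv_oo_cc u_ab.
      rewrite derive1E; have [_ ->] := weighted_derive C u u_ab.
      apply: mulr_ge0; first exact: expR_ge0.
      by have := dE_le u u_ab; rewrite ler_norml; lra.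
  by rewrite /= /GRing.mul /= Es0 mul0r pmulr_lle0 ?expR_gt0.
Qed.

(** * The multiplicative norm of the quaternions *)

Section QuaternionAlgebra.
Variable R : realType.
Implicit Types p q : quat R.

Lemma quat_mul_scaler (a : R) p q : q * (a *: p : quat R) = a *: (q * p).
Proof.
change (quat_mul q (a *: p) = a *: quat_mul q p).
by apply: quatE; rewrite /quat_mul !QuatE /qre /qi /qj /qk !mxE /=
  /qre /qi /qj /qk; ring.
Qed.

Lemma quat_mul_scalel (a : R) p q : (a *: p : quat R) * q = a *: (p * q).
Proof.
change (quat_mul (a *: p) q = a *: quat_mul p q).
by apply: quatE; rewrite /quat_mul !QuatE /qre /qi /qj /qk !mxE /=
  /qre /qi /qj /qk; ring.
Qed.

Lemma quat_sqnormM p q : quat_sqnorm (p * q) = quat_sqnorm p * quat_sqnorm q.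
Proof.
change (quat_sqnorm (quat_mul p q) = quat_sqnorm p * quat_sqnorm q).
by rewrite /quat_sqnorm /quat_mul !QuatE; ring.
Qed.

Lemma quat_sqnorm_ge0 q : 0 <= quat_sqnorm q.
Proof. by rewrite /quat_sqnorm !addr_ge0 ?sqr_ge0. Qed.

Definition quat_dot p q : R :=
  qre p * qre q + qi p * qi q + qj p * qj q + qk p * qk q.

Lemma quat_dot_sumr (I : Type) (r : seq I) p (F : I -> quat R) :
  quat_dot p (\sum_(i <- r) F i) = \sum_(i <- r) quat_dot p (F i).
Proof.
elim: r => [|i r IHr]; rewrite ?big_nil ?big_cons.
  by rewrite /quat_dot /qre /qi /qj /qk !mxE !mulr0 !addr0.
by rewrite -IHr /quat_dot !quatDE; ring.
Qed.

(** This combines the nonnegativity of the squared norms of p + q and p - q,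
    which are the right-hand side plus and minus 2 <p, q>. *)
Lemma quat_dot_le p q :
  `|2 * quat_dot p q| <= quat_sqnorm p + quat_sqnorm q.
Proof.
rewrite /quat_dot /quat_sqnorm ler_norml; apply/andP; split; rewrite -subr_ge0.
- rewrite (_ : _ - _ = (qre p + qre q) ^+ 2 + (qi p + qi q) ^+ 2
    + (qj p + qj q) ^+ 2 + (qk p + qk q) ^+ 2); last by ring.
  by rewrite !addr_ge0 ?sqr_ge0.
- rewrite (_ : _ - _ = (qre p - qre q) ^+ 2 + (qi p - qi q) ^+ 2
    + (qj p - qj q) ^+ 2 + (qk p - qk q) ^+ 2); last by ring.
  by rewrite !addr_ge0 ?sqr_ge0.
Qed.

Lemma quat_sqnorm_continuous : continuous (@quat_sqnorm R).
Proof.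
move=> q.
have coord_cvg (l : 'I_4) : (fun p : 'rV[R]_4 => p 0 l ^+ 2) @ (q : 'rV[R]_4)
    --> (q : 'rV[R]_4) 0 l ^+ 2.
  have l_cvg := @coord_continuous R 1 4 0 l q.
  exact: (cvgM l_cvg l_cvg).
exact: (cvgD (cvgD (cvgD (coord_cvg 0) (coord_cvg 1)) (coord_cvg 2))
  (coord_cvg 3)).
Qed.

Lemma is_derive_quat_sqnorm (f : R -> quat R) (t : R) (df : quat R) :
  is_derive t 1 f df ->
  is_derive t 1 (fun s => quat_sqnorm (f s)) (2 * quat_dot (f t) df).
Proof.
move=> [f_derivable f_derive].
have coord_derive (l : 'I_4) :
    is_derive t 1 (fun s => (f s : 'rV[R]_4) 0 l) ((df : 'rV[R]_4) 0 l).
  split; first exact: ((derivable_mxP f t 1).1 f_derivable 0 l).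
  by rewrite -f_derive (derive_mx f_derivable) mxE.
have sq_derive (l : 'I_4) := is_deriveX 2 (coord_derive l).
have := is_deriveD (is_deriveD (is_deriveD (sq_derive 0) (sq_derive 1))
  (sq_derive 2)) (sq_derive 3).
move=> sum_derive; apply: (is_derive_eq sum_derive).
rewrite /quat_dot /qre /qi /qj /qk /GRing.scale /= expr1; ring.
Qed.
End QuaternionAlgebra.

(** * Linear algebra over the quaternions *)

(** Injectivity implies surjectivity for real endomorphisms of H^n; the
    coefficients of w are its preimage under q |-> \sum q_i v_i. *)
Lemma quat_independent_span (R : realType) (n : nat)
    (v : 'I_n -> 'rV[quat R]_n) (w : 'rV[quat R]_n) :
  (forall q : 'I_n -> quat R,
     \sum_(i < n) q i *: v i = 0 -> forall i, q i = 0) ->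
  exists q : 'I_n -> quat R, w = \sum_(i < n) q i *: v i.
Proof.
move=> v_indep.
pose comb (u : {ffun 'I_n -> 'rV[R]_4}) : {ffun 'I_n -> 'rV[R]_4} :=
  [ffun j => \sum_(i < n) (u i : quat R) * v i 0 j].
have comb_linear : linear comb.
  move=> a u u'; apply/ffunP => j; rewrite !ffunE scaler_sumr -big_split /=.
  apply: eq_bigr => i _; rewrite !ffunE -quat_mul_scalel.
  exact: (mulrDl (a *: u i : quat R) (u' i : quat R) (v i 0 j)).
pose combL : {linear {ffun 'I_n -> 'rV[R]_4} -> {ffun 'I_n -> 'rV[R]_4}} :=
  HB.pack comb (GRing.isLinear.Build _ _ _ _ comb comb_linear).
have comb_inj : lker (linfun combL) == 0%VS.
  apply/lker0P => u u'; rewrite !(lfunE combL) => /eqP.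
  rewrite -subr_eq0 -(linearB combL) => /eqP uu'.
  apply/eqP; rewrite -subr_eq0; apply/eqP/ffunP => i; rewrite [RHS]ffunE.
  apply: (v_indep (u - u')); apply/rowP => j.
  have := congr1 (fun g : {ffun 'I_n -> 'rV[R]_4} => g j) uu'.
  rewrite !ffunE summxE => e; rewrite mxE -[RHS]e.
  by apply: eq_bigr => k _; rewrite mxE.
pose q := (linfun combL)^-1%VF [ffun j => w 0 j].
exists q; apply/rowP => j.
have /ffunP/(_ j) := lker0_lfunVK comb_inj [ffun j => w 0 j].
rewrite lfunE /= !ffunE => <-; rewrite summxE.
by apply: eq_bigr => i _; rewrite mxE.
Qed.

(** * Uniqueness for the left system *)

Lemma entry_continuous (R : numFieldType) (T : pseudoPMetricType R) (m n : nat)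
    (i : 'I_m) (j : 'I_n) : continuous (fun B : 'M[T]_(m, n) => B i j).
Proof.
move=> B V /= /nbhs_ballP[e e_gt0 eV].
by apply/nbhs_ballP; exists e => // C [_ BC]; exact: eV (BC i j).
Qed.

(** Only the real-linear structure matters here: left multiplication by q is a
    linear endomorphism of R^4, continuous as R^4 has finite dimension. *)
Lemma is_derive_quat_mull (R : realType) (q : quat R) (f : R -> quat R)
    (t : R) (df : quat R) :
  is_derive t 1 f df -> is_derive t 1 (fun s => q * f s) (q * df).
Proof.
move=> f_derive.
pose mulq (p : 'rV[R]_4) : 'rV[R]_4 := q * (p : quat R).
have mulq_linear : linear mulq.
  move=> a p p'; rewrite /mulq -quat_mul_scaler.
  exact: (mulrDr q (a *: p : quat R) (p' : quat R)).
pose mulqL : {linear 'rV[R]_4 -> 'rV[R]_4} :=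
  HB.pack mulq (GRing.isLinear.Build _ _ _ _ mulq mulq_linear).
exact: (is_derive_linear (@linear_rV_continuous R _ _ mulqL) f_derive).
Qed.

Section Solutions.
Variables (R : realType) (n : nat) (I : set R) (A : R -> 'M[quat R]_n).

(** The coefficients commute past A because they act on the other side. *)
Lemma is_solution_lincomb (m : nat) (q : 'I_m -> quat R)
    (X : 'I_m -> R -> 'rV[quat R]_n) :
  (forall i, is_solution I A (X i)) ->
  is_solution I A (fun t => \sum_(i < m) q i *: X i t).
Proof.
move=> X_sol t It j.
have term_derive i := is_derive_quat_mull (q i) (X_sol i t It j).
have sum_derive := is_derive_sum term_derive.
rewrite (_ : (fun s => _) = \sum_(i < m) (fun s => q i * X i s 0 j)); last first.
  apply/funext => s; rewrite summxE fct_sumE.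
  by apply: eq_bigr => i _; rewrite mxE.
apply: (is_derive_eq sum_derive).
rewrite mulmx_suml summxE; apply: eq_bigr => i _.
by rewrite -scalemxAl [RHS]mxE.
Qed.

Lemma is_solutionB (x y : R -> 'rV[quat R]_n) :
  is_solution I A x -> is_solution I A y ->
  is_solution I A (fun t => x t - y t).
Proof.
move=> x_sol y_sol t It j.
have sub_derive := is_deriveB (x_sol t It j) (y_sol t It j).
rewrite (_ : (fun s => _) = (fun s => x s 0 j) - (fun s => y s 0 j)); last first.
  by apply/funext => s; rewrite mxE [in LHS]mxE.
apply: (is_derive_eq sub_derive).
by rewrite mulmxBl [RHS]mxE [X in _ = _ + X]mxE.
Qed.

Definition row_energy (v : 'rV[quat R]_n) : R :=
  \sum_(j < n) quat_sqnorm (v 0 j).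

Lemma row_energy_ge0 v : 0 <= row_energy v.
Proof. by apply: sumr_ge0 => j _; exact: quat_sqnorm_ge0. Qed.

Lemma row_energy_eq0 v : row_energy v = 0 -> v = 0.
Proof.
move=> v0; apply/rowP => j; rewrite [RHS]mxE.
have sq_ge0 k : true -> 0 <= quat_sqnorm (v 0 k) by rewrite quat_sqnorm_ge0.
apply/eqP; rewrite -quat_sqnorm_eq0; apply/eqP.
exact: (psumr_eq0P sq_ge0 v0).
Qed.

(** The left-hand side is the absolute value of the derivative of the energy
    along a solution of x' = x B. *)
Lemma row_energy_dot_le (c : R) (v : 'rV[quat R]_n) (B : 'M[quat R]_n) :
  (forall k j, quat_sqnorm (B k j) <= c) ->
  `|\sum_(j < n) 2 * quat_dot (v 0 j) ((v *m B) 0 j)|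
    <= n%:R * (1 + c) * row_energy v.
Proof.
move=> B_le.
have -> : n%:R * (1 + c) * row_energy v =
    \sum_(j < n) \sum_(k < n) (quat_sqnorm (v 0 j) + quat_sqnorm (v 0 k) * c).
  under eq_bigr do rewrite big_split /= sumr_const card_ord -mulr_suml.
  rewrite big_split /= sumr_const card_ord sumrMnl -/(row_energy v).
  by rewrite -mulrA mulr_natl -mulrnDl mulrDl mul1r (mulrC c).
apply: le_trans (ler_norm_sum _ _ _) _; apply: ler_sum => j _.
rewrite [(v *m B) 0 j]mxE quat_dot_sumr mulr_sumr.
apply: le_trans (ler_norm_sum _ _ _) _; apply: ler_sum => k _.
apply: le_trans (quat_dot_le _ _) _.
by rewrite lerD2l quat_sqnormM ler_wpM2l ?quat_sqnorm_ge0.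
Qed.

(** A single bound for all entries is the maximum on [a, b] of the sum of their
    squared norms. *)
Lemma entries_bounded (a b : R) : a <= b -> {within `[a, b], continuous A} ->
  exists c, forall t, t \in `[a, b] -> forall k j, quat_sqnorm (A t k j) <= c.
Proof.
move=> ab A_cont.
pose g t := \sum_(k < n) \sum_(j < n) quat_sqnorm (A t k j).
have entry_cont k j :
    {within `[a, b], continuous (fun t => quat_sqnorm (A t k j))}.
  have sqnorm_entry_cont :
      continuous (fun B : 'M[quat R]_n => quat_sqnorm (B k j)).
    move=> B.
    exact: (continuous_comp (@entry_continuous R (quat R) n n k j B)
      (@quat_sqnorm_continuous R (B k j))).
  move=> t.
  exact: (continuous_comp (A_cont t) (sqnorm_entry_cont (A t))).
have g_cont : {within `[a, b], continuous g}.
  apply: continuous_big => [|k _]; first exact: add_continuous.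
  apply: continuous_big => [|j _]; first exact: add_continuous.
  exact: entry_cont.
have [c c_ab g_le] := EVT_max ab g_cont.
exists (g c) => t t_ab k j; apply: le_trans (g_le t t_ab).
rewrite /g (bigD1 k) //= (bigD1 j) //= -addrA lerDl addr_ge0 //.
  by apply: sumr_ge0 => l _; exact: quat_sqnorm_ge0.
by do 2![apply: sumr_ge0 => ? _]; exact: quat_sqnorm_ge0.
Qed.

(** The estimate needs A bounded, which it may fail to be on the open interval;
    hence the restriction to the segment between s and t. *)
Lemma is_solution_eq0 (x : R -> 'rV[quat R]_n) (s t : R) :
  is_interval I -> {within I, continuous A} -> is_solution I A x ->
  I s -> I t -> x s = 0 -> x t = 0.
Proof.
move=> I_itv A_cont x_sol Is It xs0.
pose a := Num.min s t; pose b := Num.max s t.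
have ab : a <= b by rewrite /a /b ge_min le_max lexx.
have ab_I u : u \in `[a, b] -> I u.
  rewrite in_itv /= => /andP[au ub].
  have Ia : I a by rewrite /a; case: ltP.
  have Ib : I b by rewrite /b; case: ltP.
  by apply: (I_itv a b Ia Ib); rewrite au ub.
have A_cont_ab : {within `[a, b], continuous A}.
  exact: continuous_subspaceW A_cont.
have [c A_le] := entries_bounded ab A_cont_ab.
apply: row_energy_eq0.
pose dE u := \sum_(j < n) 2 * quat_dot (x u 0 j) ((x u *m A u) 0 j).
apply: (@gronwall_eq0 R (row_energy \o x) dE (n%:R * (1 + c)) a b s t).
- by move=> u _; exact: row_energy_ge0.
- move=> u u_ab.
  have := is_derive_sum
    (fun j => is_derive_quat_sqnorm (x_sol u (ab_I u u_ab) j)).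
  by rewrite fct_sumE.
- by move=> u u_ab; apply: row_energy_dot_le; exact: A_le.
- by rewrite in_itv /= ge_min le_max lexx.
- by rewrite in_itv /= ge_min le_max lexx !orbT.
- rewrite /= xs0 /row_energy big1 // => j _.
  by apply/eqP; rewrite quat_sqnorm_eq0 mxE.
Qed.

End Solutions.

Theorem theorem3p5 (R : realType) (n : nat) (I : set R)
    (I_open : open I) (I_itv : is_interval I)
    (A : R -> 'M[quat R]_n) (A_cont : {within I, continuous A})
    (X : 'I_n -> R -> 'rV[quat R]_n)
    (X_sol : forall i : 'I_n, is_solution I A (X i))
    (X_indep : left_independent I X)
    (x : R -> 'rV[quat R]_n) (x_sol : is_solution I A x) :
  exists q : 'I_n -> quat R,
    forall t : R, I t -> x t = \sum_(i < n) q i *: X i t.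
Proof.
(* On the empty interval there is no t0, and any constants will do. *)
have [->|/set0P[t0 It0]] := eqVneq I set0; first by exists (fun=> 0).
have X_indep_t0 (q : 'I_n -> quat R) :
    \sum_(i < n) q i *: X i t0 = 0 -> forall i, q i = 0.
  move=> comb0 i; apply/eqP; apply: contra_notT X_indep => qi0.
  exists q; split=> [|t It]; first by exists i.
  exact: (is_solution_eq0 I_itv A_cont (is_solution_lincomb q X_sol) It0 It).
have [q x_t0] := quat_independent_span (x t0) X_indep_t0.
exists q => t It; apply/eqP; rewrite -subr_eq0; apply/eqP.
apply: (is_solution_eq0 I_itv A_cont
  (is_solutionB x_sol (is_solution_lincomb q X_sol)) It0 It).
by rewrite -x_t0 subrr.
Qed.
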